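(* Consider the problem $\min_{x\in\mathbb{R}^n} h(x)+P(\mathcal{M}x)$ and the proximal ADMM with input $(x^0,z^0)$, $\beta$ and $\phi$, as described in the context, and suppose that Assumption A (stated in the context) holds. Let $\{(x^t,y^t,z^t)\}$ be any sequence generated by the proximal ADMM. Then: (i) (Global subsequential convergence) If $\{(x^t,y^t,z^t)\}$ has a cluster point $(x^*,y^*,z^* )$, then $$\lim_{t\to\infty}\left(\|y^{t+1}-y^t\|^2+\|x^{t+1}-x^t\|^2+\|z^{t+1}-z^t\|^2\right)=0.$$ Moreover, $x^*$ is a stationary point of the problem $\min_x h(x)+P(\mathcal{M}x)$, and $$\nabla h(x^* )=\mathcal{M}^*z^*,\qquad -z^*\in\partial P(y^* ),\qquad y^*=\mathcal{M}x^*.$$ (ii) (Strict improvement in objective values) Suppose that the algorithm is initialized at a non-stationary $x^0$ with $h(x^0)+P(\mathcal{M}x^0)<\infty$, and at $z^0$ satisfying $\mathcal{M}^*z^0=\nabla h(x^0)$. Then for any cluster point $(x^*,y^*,z^* )$ of $\{(x^t,y^t,z^t)\}$, if one exists, $$h(x^* )+P(\mathcal{M}x^* )<h(x^0)+P(\mathcal{M}x^0).$$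
   Context: Setting. $\mathcal{M}:\mathbb{R}^n\to\mathbb{R}^m$ is a linear map with adjoint $\mathcal{M}^*$; $h:\mathbb{R}^n\to\mathbb{R}$ is twice continuously differentiable with bounded Hessian; $P:\mathbb{R}^m\to(-\infty,\infty]$ is proper (finite somewhere, never $-\infty$) and closed (lower semicontinuous), possibly nonconvex, and for every $u\in\mathbb{R}^m$ and $\tau>0$ the set of minimizers of $y\mapsto \tau P(y)+\frac12\|y-u\|^2$ is nonempty. $\operatorname{Arg\,min}$ denotes the set of (global) minimizers. Notation. $\mathcal{I}$ is the identity map. For symmetric linear self-maps, $\mathcal{T}_1\succeq\mathcal{T}_2$ (resp. $\succ$) means $\mathcal{T}_1-\mathcal{T}_2$ is positive semidefinite (resp. positive definite). For a continuously differentiable $\phi$, the Bregman distance is $D_\phi(x_1,x_2):=\phi(x_1)-\phi(x_2)-\langle\nabla\phi(x_2),x_1-x_2\rangle$. Subdifferential. For a proper $f$ and $x\in\mathrm{dom}\,f=\{x: f(x)<\infty\}$, $\partial f(x)$ is the limiting subdifferential: the set of $v$ for which there exist $x^t\to x$ with $f(x^t)\to f(x)$ and $v^t\to v$ such that $\liminf_{z\to x^t,\, z\ne x^t}\frac{f(z)-f(x^t)-\langle v^t,z-x^t\rangle}{\|z-x^t\|}\ge0$ for each $t$; $\partial f(x)=\emptyset$ for $x\notin\mathrm{dom}\,f$. A point $\tilde x$ is a stationary point of $\min_x h(x)+P(\mathcal{M}x)$ if $0\in\nabla h(\tilde x)+\mathcal{M}^*\partial P(\mathcal{M}\tilde x)$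 (for surjective $\mathcal{M}$ this is the same as $0\in\partial(h+P\circ\mathcal{M})(\tilde x)$); otherwise it is non-stationary. Algorithm (proximal ADMM). For $\beta>0$ let $$L_\beta(x,y,z):=h(x)+P(y)-\langle z,\mathcal{M}x-y\rangle+\frac{\beta}{2}\|\mathcal{M}x-y\|^2.$$ Given input $(x^0,z^0)\in\mathbb{R}^n\times\mathbb{R}^m$, $\beta>0$ and a twice continuously differentiable convex function $\phi:\mathbb{R}^n\to\mathbb{R}$, for $t=0,1,2,\dots$: $$y^{t+1}\in\operatorname{Arg\,min}_y L_\beta(x^t,y,z^t),\quad x^{t+1}\in\operatorname{Arg\,min}_x\{L_\beta(x,y^{t+1},z^t)+D_\phi(x,x^t)\},\quad z^{t+1}=z^t-\beta(\mathcal{M}x^{t+1}-y^{t+1}).$$ Assumption A. (i) $\mathcal{M}\mathcal{M}^*\succeq\sigma\mathcal{I}$ for some $\sigma>0$; and there exist symmetric linear self-maps $\mathcal{Q}_1,\mathcal{Q}_2$ of $\mathbb{R}^n$ such that $\mathcal{Q}_1\succeq\nabla^2h(x)\succeq\mathcal{Q}_2$ for all $x$. (ii) $\beta>0$ and $\phi$ are chosen so that: (a) there exist symmetric $\mathcal{T}_1\succeq\mathcal{T}_2\succeq0$ with $\mathcal{T}_1^2\succeq[\nabla^2\phi(x)]^2\succeq\mathcal{T}_2^2$ for all $x$; (b) $\mathcal{Q}_2+\beta\mathcal{M}^*\mathcal{M}+\mathcal{T}_2\succeq\delta\mathcal{I}$ for some $\delta>0$; (c) with a symmetric $\mathcal{Q}_3$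 satisfying $\mathcal{Q}_3\succeq[\nabla^2h(x)+\nabla^2\phi(x)]^2$ for all $x$, there exists $\gamma\in(0,1)$ such that $\delta\mathcal{I}+\mathcal{T}_2\succ\frac{2}{\sigma\beta}\mathcal{H}_\gamma$, where $\mathcal{H}_\gamma:=\frac1\gamma\mathcal{Q}_3+\frac1{1-\gamma}\mathcal{T}_1^2$. *)

(* Defs.v *)
From HB Require Import structures.
From mathcomp Require Import all_boot all_order all_algebra sesquilinear.
From mathcomp Require Import all_classical all_reals all_analysis.
Import Order.TTheory GRing.Theory Num.Theory.
Import numFieldNormedType.Exports.

Set Implicit Arguments.
Unset Strict Implicit.
Unset Printing Implicit Defensive.

Local Open Scope classical_set_scope.
Local Open Scope ring_scope.

(* Vectors are columns, linear maps are matrices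
   acting on the left, and the adjoint of M is M^T.  The library norm
   on 'cV[R]_n is the sup norm; it is used only through the topology and the
   differentiability it induces.  Metric quantities use vnorm. *)

Section Euclidean.
Context {R : realType}.

Definition dotp (n : nat) (u v : 'cV[R]_n) : R := (u^T *m v) 0 0.

Definition vnorm (n : nat) (u : 'cV[R]_n) : R := Num.sqrt (dotp u u).

(* Symmetry is not part of psd and pd; where it is needed and not automatic it
   is a separate hypothesis. *)
Definition psd (n : nat) (T : 'M[R]_n) : Prop :=
  forall u : 'cV[R]_n, 0 <= dotp u (T *m u).

Definition pd (n : nat) (T : 'M[R]_n) : Prop :=
  forall u : 'cV[R]_n, u != 0 -> 0 < dotp u (T *m u).

Definition loewner_ge (n : nat) (T1 T2 : 'M[R]_n) : Prop := psd (T1 - T2).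
Definition loewner_gt (n : nat) (T1 T2 : 'M[R]_n) : Prop := pd (T1 - T2).

End Euclidean.

Section Smooth.
Context {R : realType} {n : nat}.
Implicit Types f : 'cV[R]_n -> R.

Definition gradient f (x : 'cV[R]_n) : 'cV[R]_n :=
  \col_i 'D_(delta_mx i 0) f x.

Definition hessian f (x : 'cV[R]_n) : 'M[R]_n :=
  \matrix_(i, j) ('D_(delta_mx j 0) (gradient f) x) i 0.

(* The derivative operators are total, with junk values at points of
   non-differentiability, hence the differentiability clauses. *)
Definition twice_continuously_differentiable f : Prop :=
  [/\ forall x, differentiable f x,
      forall x, differentiable (gradient f) x
    & continuous (hessian f)].

Definition bregman f (x1 x2 : 'cV[R]_n) : R :=
  f x1 - f x2 - dotp (gradient f x2) (x1 - x2).

End Smooth.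

Definition argmin {R : realType} {T : Type} (f : T -> \bar R) : set T :=
  [set x | forall y, (f x <= f y)%E].

Section Extended.
Context {R : realType} {m : nat}.
Implicit Types P : 'cV[R]_m -> \bar R.

Definition proper_fun P : Prop :=
  (forall y, P y != -oo%E) /\ (exists y, (P y < +oo)%E).

Definition prox_nonempty P : Prop :=
  forall (u : 'cV[R]_m) (tau : R), 0 < tau ->
    argmin (fun y => tau%:E * P y + (2^-1 * vnorm (y - u) ^+ 2)%:E)%E !=set0.

(* If m = 0 the deleted neighbourhoods of a point include the empty set, and
   the lower limit below is +oo, so that every v qualifies. *)
Definition frechet_subdiff P (x : 'cV[R]_m) : set 'cV[R]_m :=
  [set v | (P x < +oo)%E /\
    (0 <= limf_einf (fun z : 'cV[R]_m =>
            (P z - P x - (dotp v (z - x))%:E) * ((vnorm (z - x))^-1)%:E)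
          x^')%E].

Definition limiting_subdiff P (x : 'cV[R]_m) : set 'cV[R]_m :=
  [set v | (P x < +oo)%E /\
    exists (xs vs : nat -> 'cV[R]_m),
      [/\ xs @ \oo --> x,
          P \o xs @ \oo --> P x,
          vs @ \oo --> v
        & forall t, frechet_subdiff P (xs t) (vs t)]].

End Extended.

Section ADMM.
Context {R : realType} {n m : nat}.
Variables (M : 'M[R]_(m, n)) (h : 'cV[R]_n -> R) (P : 'cV[R]_m -> \bar R).

Definition objective (x : 'cV[R]_n) : \bar R := ((h x)%:E + P (M *m x))%E.

Definition stationary (x : 'cV[R]_n) : Prop :=
  exists2 xi, limiting_subdiff P (M *m x) xi & 0 = gradient h x + M^T *m xi.

Definition aug_lagrangian (beta : R) (x : 'cV[R]_n) (y z : 'cV[R]_m) : \bar R :=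
  ((h x)%:E + P y - (dotp z (M *m x - y))%:E
   + (beta / 2 * vnorm (M *m x - y) ^+ 2)%:E)%E.

(* The iterates y are defined from index 1 on: y 0 is unconstrained. *)
Definition proximal_admm (beta : R) (phi : 'cV[R]_n -> R)
    (x0 : 'cV[R]_n) (z0 : 'cV[R]_m)
    (x : nat -> 'cV[R]_n) (y z : nat -> 'cV[R]_m) : Prop :=
  [/\ x 0%N = x0, z 0%N = z0
    & forall t : nat,
      [/\ argmin (fun y' => aug_lagrangian beta (x t) y' (z t)) (y t.+1),
          argmin (fun x' => aug_lagrangian beta x' (y t.+1) (z t)
                            + (bregman phi x' (x t))%:E)%E (x t.+1)
        & z t.+1 = z t - beta *: (M *m x t.+1 - y t.+1)]].

Definition assumptionA (beta : R) (phi : 'cV[R]_n -> R) : Prop :=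
  exists (sigma delta gamma : R) (Q1 Q2 Q3 T1 T2 : 'M[R]_n),
    [/\ [/\ 0 < sigma & loewner_ge (M *m M^T) sigma%:M],
        [/\ Q1 \is symmetricmx, Q2 \is symmetricmx
          & forall x, loewner_ge Q1 (hessian h x) /\
                      loewner_ge (hessian h x) Q2],
        [/\ T1 \is symmetricmx, T2 \is symmetricmx, loewner_ge T1 T2,
            loewner_ge T2 0
          & forall x, loewner_ge (T1 *m T1) (hessian phi x *m hessian phi x) /\
                      loewner_ge (hessian phi x *m hessian phi x) (T2 *m T2)],
        [/\ 0 < delta
          & loewner_ge (Q2 + beta *: (M^T *m M) + T2) delta%:M]
      & [/\ Q3 \is symmetricmx,
            forall x, loewner_ge Q3 ((hessian h x + hessian phi x) *m
                                     (hessian h x + hessian phi x)),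
            0 < gamma < 1
          & loewner_gt (delta%:M + T2)
              ((2 / (sigma * beta)) *:
                 (gamma^-1 *: Q3 + (1 - gamma)^-1 *: (T1 *m T1)))]].

End ADMM.

(* Main.v *)
Require Import Defs.
From HB Require Import structures.
From mathcomp Require Import all_boot all_order all_algebra sesquilinear.
From mathcomp Require Import all_classical all_reals all_analysis.
From mathcomp Require Import ring lra.
Import Order.TTheory GRing.Theory Num.Theory.
Import numFieldNormedType.Exports.
Local Open Scope classical_set_scope.
Local Open Scope ring_scope.

(** Convergence rests on a potential: the augmented Lagrangian plus a multiple
    of the squared length, in the form [T1 ^ 2], of the last primal increment.
    Write [dx] for a primal increment and [D] for the positive definite form
    [delta I + T2 - 2 / (sigma beta) H_gamma]; the potential drops by at least
    [1/2 <dx, D dx>] in every iteration ([potential_decrease],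
    [potential_step]).  The three updates contribute as follows.

    - The [y]-step does not increase the Lagrangian ([y_step_le]).
    - The [x]-step decreases it by [1/2 <dx, (delta I + T2) dx>]
      ([x_step_descent]).  The Hessian of the convex function [phi] dominates
      [T2], because the order of squares of positive semidefinite matrices
      passes to the matrices ([loewner_heinz]).
    - The [z]-step increases it by [|z1 - z0| ^ 2 / beta].  The optimality
      condition of the [x]-step expresses [M^T z] through gradients, so that
      this is at most a combination of the squared lengths of the last two
      primal increments ([dual_increment_le]).  Squares of Hessians enter here
      through [increment_sqnorm] and the symmetry of second derivatives
      ([hessian_tr]).

    If a cluster point exists, lower semicontinuity of [P] bounds the potential
    from below by the value of the Lagrangian there ([potential_ge]).  The
    potential then converges, its differences tend to [0], and so do all
    increments.  The optimality conditions of the three steps pass to the limit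
    along a subsequence: the values of [P] converge to the value at the cluster
    point by minimality in the [y]-steps ([cluster_subdiff]).

    For the strict improvement, the condition [M^T z0 = grad h x0] makes the
    first iteration behave as if it followed a null increment, so the potential
    after it is at most the initial objective value minus [1/2 <dx, D dx>].
    If [dx = 0], the first iteration exhibits [x0] as a stationary point;
    otherwise the decrease is strict, and the cluster value lies below
    ([cluster_objective_lt]). *)

Set Implicit Arguments.
Unset Strict Implicit.
Unset Printing Implicit Defensive.

(** * Inner product and topology of column vectors *)

Section InnerProduct.
Context {R : realType}.

Lemma dotpE n (u v : 'cV[R]_n) : dotp u v = \sum_i u i 0 * v i 0.
Proof. by rewrite /dotp mxE; apply: eq_bigr => i _; rewrite mxE. Qed.

Lemma dotpC n (u v : 'cV[R]_n) : dotp u v = dotp v u.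
Proof. by rewrite !dotpE; apply: eq_bigr => i _; rewrite mulrC. Qed.

Lemma dotpDr n (u v w : 'cV[R]_n) : dotp u (v + w) = dotp u v + dotp u w.
Proof. by rewrite /dotp mulmxDr mxE. Qed.

Lemma dotpDl n (u v w : 'cV[R]_n) : dotp (v + w) u = dotp v u + dotp w u.
Proof. by rewrite dotpC dotpDr !(dotpC u). Qed.

Lemma dotpZr n a (u v : 'cV[R]_n) : dotp u (a *: v) = a * dotp u v.
Proof. by rewrite /dotp -scalemxAr mxE. Qed.

Lemma dotpZl n a (u v : 'cV[R]_n) : dotp (a *: v) u = a * dotp v u.
Proof. by rewrite dotpC dotpZr dotpC. Qed.

Lemma dotpNr n (u v : 'cV[R]_n) : dotp u (- v) = - dotp u v.
Proof. by rewrite -scaleN1r dotpZr mulN1r. Qed.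

Lemma dotpNl n (u v : 'cV[R]_n) : dotp (- v) u = - dotp v u.
Proof. by rewrite dotpC dotpNr dotpC. Qed.

Lemma dotpBr n (u v w : 'cV[R]_n) : dotp u (v - w) = dotp u v - dotp u w.
Proof. by rewrite dotpDr dotpNr. Qed.

Lemma dotpBl n (u v w : 'cV[R]_n) : dotp (v - w) u = dotp v u - dotp w u.
Proof. by rewrite dotpDl dotpNl. Qed.

Lemma dotp0r n (u : 'cV[R]_n) : dotp u 0 = 0.
Proof. by rewrite -(scale0r 0) dotpZr mul0r. Qed.

Definition dotp_linE := (dotpDr, dotpDl, dotpBr, dotpBl, dotpNr, dotpNl,
  dotpZr, dotpZl).

Lemma dotp_mulmxr m n (A : 'M[R]_(m, n)) (u : 'cV[R]_m) (v : 'cV[R]_n) :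
  dotp u (A *m v) = dotp (A^T *m u) v.
Proof. by rewrite /dotp trmx_mul trmxK mulmxA. Qed.

Lemma dotp_ge0 n (u : 'cV[R]_n) : 0 <= dotp u u.
Proof. by rewrite dotpE sumr_ge0// => i _; rewrite -expr2 sqr_ge0. Qed.

Lemma coord_le_dotp n (u : 'cV[R]_n) i : u i 0 ^+ 2 <= dotp u u.
Proof.
rewrite dotpE (bigD1 i)//= expr2 lerDl sumr_ge0// => j _.
by rewrite -expr2 sqr_ge0.
Qed.

Lemma dotp_eq0 n (u : 'cV[R]_n) : (dotp u u == 0) = (u == 0).
Proof.
apply/eqP/eqP => [u0|->]; last exact: dotp0r.
apply/colP => i; rewrite mxE; apply/eqP; rewrite -sqrf_eq0 eq_le sqr_ge0 andbT.
by rewrite -u0 coord_le_dotp.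
Qed.

Lemma dotp_gt0 n (u : 'cV[R]_n) : (0 < dotp u u) = (u != 0).
Proof. by rewrite lt_def dotp_ge0 andbT dotp_eq0. Qed.

Lemma vnorm_sqr n (u : 'cV[R]_n) : vnorm u ^+ 2 = dotp u u.
Proof. by rewrite sqr_sqrtr// dotp_ge0. Qed.

Lemma dotp_inj n (u v : 'cV[R]_n) : (forall w, dotp u w = dotp v w) -> u = v.
Proof.
by move=> uv; apply/eqP; rewrite -subr_eq0 -dotp_eq0 dotpBl uv subrr.
Qed.

(** The value at the vertex [- b / c] is [(a c - b ^ 2) / c]. *)
Lemma quadratic_discr (a b c : R) :
  (forall s, 0 <= a + 2 * s * b + s ^+ 2 * c) -> b ^+ 2 <= a * c.
Proof.
move=> q.
have c0 : 0 <= c.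
  rewrite leNgt; apply/negP => c0.
  have a0 : 0 <= a by have := q 0; rewrite mulr0 mul0r expr0n/= mul0r !addr0.
  (* The values at [k] and [- k] add up to [2 (a + k ^ 2 c)], and
     [k ^ 2 >= k] makes this negative. *)
  have k0 : 0 < 1 + (a + 1) / - c.
    by rewrite addr_gt0// divr_gt0 ?oppr_gt0//; lra.
  set k := 1 + _ in k0.
  have := q k; have := q (- k) => q1 q2.
  have kc : k * - c = - c + (a + 1) by rewrite /k; field; lra.
  have : k ^+ 2 * c = - (k * (- c + (a + 1))) by rewrite -kc; ring.
  have : 1 <= k by rewrite /k lerDl divr_ge0//; lra.
  nra.
have [c00|cn0] := eqVneq c 0.
  rewrite c00 mulr0.
  have [->|b0] := eqVneq b 0; first by rewrite expr0n.
  have := q (- (a + 1) / (2 * b)); rewrite c00 mulr0 addr0.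
  have -> : 2 * (- (a + 1) / (2 * b)) * b = - (a + 1) by field.
  lra.
have := q (- b / c).
have -> : a + 2 * (- b / c) * b + (- b / c) ^+ 2 * c = (a * c - b ^+ 2) / c.
  by field.
by rewrite pmulr_lge0 ?invr_gt0 ?lt_def ?cn0// subr_ge0.
Qed.

Lemma psd_cauchy_schwarz n (T : 'M[R]_n) (u v : 'cV[R]_n) :
  T^T = T -> psd T ->
  dotp u (T *m v) ^+ 2 <= dotp u (T *m u) * dotp v (T *m v).
Proof.
move=> Tsym Tpsd; apply: quadratic_discr => s.
have := Tpsd (u + s *: v); rewrite mulmxDr -scalemxAr !dotp_linE.
rewrite (_ : dotp v (T *m u) = dotp u (T *m v)); last first.
  by rewrite dotp_mulmxr Tsym dotpC.
by congr (_ <= _); ring.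
Qed.

Lemma cauchy_schwarz n (u v : 'cV[R]_n) :
  dotp u v ^+ 2 <= dotp u u * dotp v v.
Proof.
have := @psd_cauchy_schwarz _ 1%:M u v (trmx1 _ _).
by rewrite !mul1mx; apply => w; rewrite mul1mx dotp_ge0.
Qed.

Lemma loewner_geP n (S T : 'M[R]_n) :
  loewner_ge S T <-> forall u, dotp u (T *m u) <= dotp u (S *m u).
Proof.
by split=> ST u; have := ST u; rewrite mulmxBl dotpBr subr_ge0.
Qed.

Lemma symmetricmx_tr n (T : 'M[R]_n) : T \is symmetricmx -> T^T = T.
Proof.
by move=> /is_hermitianmxP; rewrite expr0 scale1r map_mx_id// => {1}->.
Qed.

Lemma dotp_sym n (T : 'M[R]_n) u v : T^T = T ->
  dotp u (T *m v) = dotp (T *m u) v.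
Proof. by move=> {1}<-; rewrite dotp_mulmxr trmxK. Qed.

End InnerProduct.

Section Topology.
Context {R : realType}.

Lemma cvg_matrix m n (T : Type) (F : set_system T) {FF : Filter F}
    (f : T -> 'M[R]_(m, n)) (l : 'M[R]_(m, n)) :
  (forall i j, (fun t => f t i j) @ F --> l i j) -> f @ F --> l.
Proof.
move=> fl; apply/cvg_ballP => e e0.
have : \forall t \near F, forall i j, ball (l i j) e (f t i j).
  apply: filter_forall => i; apply: filter_forall => j.
  by have /cvg_ballP := fl i j; apply.
by apply: filterS => t ft; split.
Qed.

Lemma cvg_coord m n (T : Type) (F : set_system T) {FF : Filter F}
    (f : T -> 'M[R]_(m, n)) (l : 'M[R]_(m, n)) i j :
  f @ F --> l -> (fun t => f t i j) @ F --> l i j.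
Proof.
move=> fl; apply: (@continuous_cvg _ _ _ F FF f (fun N : 'M[R]_(m, n) => N i j) l) => //.
exact: coord_continuous.
Qed.

Lemma cvg_mulmx m n p (T : Type) (F : set_system T) {FF : Filter F}
    (f : T -> 'M[R]_(m, n)) (g : T -> 'M[R]_(n, p)) (a : 'M[R]_(m, n))
    (b : 'M[R]_(n, p)) :
  f @ F --> a -> g @ F --> b -> (fun t => f t *m g t) @ F --> a *m b.
Proof.
move=> fa gb; apply: cvg_matrix => i j; rewrite mxE.
under eq_fun do rewrite mxE.
apply: cvg_big => [|k _]; first exact: add_continuous.
by apply: cvgM; exact: cvg_coord.
Qed.

Lemma cvg_trmx m n (T : Type) (F : set_system T) {FF : Filter F}
    (f : T -> 'M[R]_(m, n)) (l : 'M[R]_(m, n)) :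
  f @ F --> l -> (fun t => (f t)^T) @ F --> l^T.
Proof.
move=> fl; apply: cvg_matrix => i j; rewrite mxE.
by under eq_fun do rewrite mxE; exact: cvg_coord.
Qed.

Lemma trmx_continuous m n : continuous (@trmx R m n).
Proof. by move=> A; apply: (@cvg_trmx _ _ _ _ (nbhs_filter A)); exact: cvg_id. Qed.

Lemma cvg_dotp n (T : Type) (F : set_system T) {FF : Filter F}
    (f g : T -> 'cV[R]_n) (a b : 'cV[R]_n) :
  f @ F --> a -> g @ F --> b -> (fun t => dotp (f t) (g t)) @ F --> dotp a b.
Proof.
move=> fa gb; apply: (@cvg_coord 1 1 _ _ _ (fun t => (f t)^T *m g t)).
by apply: cvg_mulmx => //; exact: cvg_trmx.
Qed.

(** Vectors carry the topology of the sup norm, which the Euclidean norm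
    dominates. *)
Lemma cvg0_dotp n (T : Type) (F : set_system T) {FF : Filter F}
    (f : T -> 'cV[R]_n) :
  (fun t => dotp (f t) (f t)) @ F --> (0 : R) -> f @ F --> (0 : 'cV[R]_n).
Proof.
move=> f0; apply: cvg_matrix => i j; rewrite mxE ord1.
apply: norm_cvg0; apply/cvgrPdist_lt => e e0.
have /cvgrPdist_lt/(_ _ (exprn_gt0 2 e0)) := f0.
apply: filterS => t; rewrite !sub0r !normrN normr_id (ger0_norm (dotp_ge0 _)) => ft.
rewrite -(@ltr_pXn2r _ 2)// ?nnegrE ?(ltW e0)//.
by rewrite real_normK ?num_real// (le_lt_trans (coord_le_dotp _ _)).
Qed.

End Topology.

(** * Second-order calculus *)

Section Lines.
Context {R : realType}.

Lemma is_derive_line (V W : normedModType R) (f : V -> W) x u (s : R) df :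
  is_derive (x + s *: u) u f df ->
  is_derive s (1 : R) (fun t => f (x + t *: u)) df.
Proof.
move=> [fd fE].
have E : (fun k : R => k^-1 *: (((fun t => f (x + t *: u)) \o shift s) (k *: 1)
            - f (x + s *: u))) =
         (fun k : R => k^-1 *: ((f \o shift (x + s *: u)) (k *: u)
            - f (x + s *: u))).
  apply/funext => k /=; congr (_ *: (f _ - _)).
  by rewrite [k *: 1]mulr1 scalerDl addrCA.
by split; [rewrite /derivable E | rewrite /derive E].
Qed.

Lemma is_derive_dotp (V : normedModType R) n (F : V -> 'cV[R]_n) x u w dF :
  is_derive x u F dF -> is_derive x u (fun y => dotp w (F y)) (dotp w dF).
Proof.
move=> [Fd FE].
have dF_cvg : (fun k : R => k^-1 *: ((F \o shift x) (k *: u) - F x)) @ 0^'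
    --> dF by rewrite -FE; exact: Fd.
have E : (fun k : R => k^-1 *: (((fun y => dotp w (F y)) \o shift x) (k *: u)
            - dotp w (F x))) =
         (fun k : R => dotp w (k^-1 *: ((F \o shift x) (k *: u) - F x))).
  by apply/funext => k /=; rewrite dotpZr dotpBr.
have c : (fun k : R => k^-1 *: (((fun y => dotp w (F y)) \o shift x) (k *: u)
            - dotp w (F x))) @ 0^' --> dotp w dF.
  by rewrite E; apply: cvg_dotp => //; exact: cvg_cst.
by split; [apply/cvg_ex; exists (dotp w dF) | exact: cvg_lim].
Qed.

Lemma mean_value_real (g dg : R -> R) (r : R) : 0 < r ->
  (forall s, is_derive s (1 : R) g (dg s)) ->
  exists2 c, 0 < c < r & g r - g 0 = r * dg c.
Proof.
move=> r0 gd; have gc : {within `[0, r], continuous g}.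
  apply: derivable_within_continuous => s _.
  exact: (@ex_derive _ _ _ _ _ _ _ (gd s)).
have [c] := @MVT R g dg 0 r r0 (fun s _ => gd s) gc.
by rewrite in_itv/= => c0r ->; exists c => //; rewrite subr0 mulrC.
Qed.

(** A vector-valued map has no exact mean value point, but its component along
    any fixed direction [w] has one. *)
Lemma mean_value_dotp n (F : 'cV[R]_n -> 'cV[R]_n) (A : 'cV[R]_n -> 'M[R]_n)
    x w v (r : R) :
  (forall y u, is_derive y u F (A y *m u)) -> 0 < r ->
  exists2 c, 0 < c < r & dotp w (F (x + r *: v)) - dotp w (F x) =
                         r * dotp w (A (x + c *: v) *m v).
Proof.
move=> FA r0.
have gd s : is_derive s (1 : R) (fun s => dotp w (F (x + s *: v)))
    (dotp w (A (x + s *: v) *m v)).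
  by apply: is_derive_dotp; apply: is_derive_line.
have [c c01] := mean_value_real r0 gd.
by rewrite scale0r addr0 => ->; exists c.
Qed.

(** With [w] the increment itself, the mean value theorem writes its squared
    norm as an inner product with [A y *m d], and the Cauchy-Schwarz inequality
    concludes. *)
Lemma increment_sqnorm n (F : 'cV[R]_n -> 'cV[R]_n) (A : 'cV[R]_n -> 'M[R]_n)
    x d q :
  (forall y u, is_derive y u F (A y *m u)) ->
  (forall y, dotp (A y *m d) (A y *m d) <= q) ->
  dotp (F (x + d) - F x) (F (x + d) - F x) <= q.
Proof.
move=> FA Aq; set a := F (x + d) - F x.
have [c _] := mean_value_dotp x a d FA ltr01.
rewrite scale1r mul1r -dotpBr -/a => aE.
have := cauchy_schwarz a (A (x + c *: d) *m d); rewrite -aE => CS.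
apply: le_trans (Aq (x + c *: d)).
have [/eqP|a0] := eqVneq (dotp a a) 0; first by rewrite dotp_eq0 => /eqP->;
  rewrite dotp0r dotp_ge0.
by rewrite -(@ler_pM2l _ (dotp a a)) -?expr2// lt_def a0 dotp_ge0.
Qed.

End Lines.

Section Hessian.
Context {R : realType} {n : nat}.
Implicit Types f : 'cV[R]_n -> R.

Lemma cV_delta (v : 'cV[R]_n) : v = \sum_i v i 0 *: delta_mx i 0.
Proof.
rewrite {1}[v]matrix_sum_delta; apply: eq_bigr => i _.
by rewrite big_ord1.
Qed.

Lemma derive_sum_delta (W : normedModType R) (F : 'cV[R]_n -> W) x u :
  differentiable F x -> 'D_u F x = \sum_i u i 0 *: 'D_(delta_mx i 0) F x.
Proof.
move=> Fx; rewrite deriveE// {1}[u]cV_delta linear_sum; apply: eq_bigr => i _.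
by rewrite linearZ/= deriveE.
Qed.

Lemma is_derive_gradient f x u : twice_continuously_differentiable f ->
  is_derive x u f (dotp (gradient f x) u).
Proof.
move=> [df _ _]; split; first exact: diff_derivable.
rewrite derive_sum_delta// dotpE; apply: eq_bigr => i _.
by rewrite mxE; exact: mulrC.
Qed.

Lemma is_derive_hessian f x u : twice_continuously_differentiable f ->
  is_derive x u (gradient f) (hessian f x *m u).
Proof.
move=> [_ dg _]; split; first exact: diff_derivable.
rewrite derive_sum_delta//; apply/colP => i; rewrite summxE mxE.
by apply: eq_bigr => j _; rewrite [in LHS]mxE [in RHS]mxE mulrC.
Qed.

Lemma continuous_gradient f : twice_continuously_differentiable f ->
  continuous (gradient f).
Proof. by move=> [_ dg _] x; exact: differentiable_continuous. Qed.

(** Along the segment, [f] minus its quadratic minorant has a derivative that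
    is nonnegative by the mean value theorem for the gradient; a second use of
    the mean value theorem compares the endpoints. *)
Lemma taylor_lower_bound f x u q : twice_continuously_differentiable f ->
  (forall y, q <= dotp u (hessian f y *m u)) ->
  dotp (gradient f x) u + q / 2 <= f (x + u) - f x.
Proof.
move=> f2 Hq.
pose dg s := dotp (gradient f (x + s *: u)) u - dotp (gradient f x) u - q * s.
have gd s : is_derive s (1 : R) (fun t => f (x + t *: u) - dotp (gradient f x) u * t
    - q / 2 * (t * t)) (dg s).
  have h1 : is_derive s (1 : R) (fun t => f (x + t *: u))
                      (dotp (gradient f (x + s *: u)) u).
    by apply: is_derive_line; exact: is_derive_gradient.
  have h2 : is_derive s (1 : R) (fun t => t : R) 1 by exact: is_derive_id.
  by apply: is_derive_eq; rewrite /dg /GRing.scale/= !mulr1; lra.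
have [c /andP[c0 _]] := mean_value_real ltr01 gd.
rewrite scale1r scale0r addr0 mul1r /dg => gE.
have [d _] := mean_value_dotp x u u (fun y v => is_derive_hessian y v f2) c0.
rewrite !(dotpC u (gradient _ _)) => gE2.
have : c * q <= c * dotp u (hessian f (x + d *: u) *m u) by rewrite ler_pM2l.
by rewrite -gE2; lra.
Qed.

Definition second_difference f x u v r :=
  f (x + r *: u + r *: v) - f (x + r *: u) - f (x + r *: v) + f x.

(** The mean value theorem is applied first to the increment of [f] in the
    direction [v], as a function of the position along [u], and then to the
    gradient in the direction [v]. *)
Lemma second_difference_mean_value f x u v r :
  twice_continuously_differentiable f -> 0 < r ->
  exists c d, [/\ 0 < c < r, 0 < d < r & second_difference f x u v r =
    r ^+ 2 * dotp u (hessian f (x + c *: u + d *: v) *m v)].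
Proof.
move=> f2 r0.
have gd s : is_derive s (1 : R)
    (fun t => f (x + r *: v + t *: u) - f (x + t *: u))
    (dotp (gradient f (x + r *: v + s *: u)) u - dotp (gradient f (x + s *: u)) u).
  by apply: is_deriveB; apply: is_derive_line; exact: is_derive_gradient.
have [c c01] := mean_value_real r0 gd; rewrite scale0r !addr0 => cE.
have [d d01] := mean_value_dotp (x + c *: u) u v
  (fun y v => is_derive_hessian y v f2) r0.
rewrite !(dotpC u (gradient _ _)) => dE.
exists c, d; split => //; rewrite expr2 -mulrA -dE /second_difference.
by move: cE; rewrite !(addrAC x (r *: v)) => cE; lra.
Qed.

(** The mean value points of the previous lemma tend to [x] with the step, and
    the Hessian is continuous. *)
Lemma second_difference_seq f x u v : twice_continuously_differentiable f ->
  exists2 H : R^nat, H @ \oo --> dotp u (hessian f x *m v) &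
    forall k, second_difference f x u v (k.+1%:R^-1) = (k.+1%:R^-1) ^+ 2 * H k.
Proof.
move=> f2.
have /choice[cd cdP] : forall k : nat, exists cd : R * R,
    [/\ 0 < cd.1 < k.+1%:R^-1, 0 < cd.2 < k.+1%:R^-1 &
      second_difference f x u v (k.+1%:R^-1) = (k.+1%:R^-1) ^+ 2 *
        dotp u (hessian f (x + cd.1 *: u + cd.2 *: v) *m v)].
  move=> k; have k0 : 0 < (k.+1%:R^-1 : R) by rewrite invr_gt0.
  have [c [d cdP]] := second_difference_mean_value x u v f2 k0.
  by exists (c, d).
have to0 (g : R^nat) : (forall k, 0 < g k < k.+1%:R^-1) -> g @ \oo --> (0 : R).
  move=> g0; apply: (@squeeze_cvgr _ _ _ _ (cst 0) harmonic).
  - by apply: nearW => k; have /andP[/ltW-> /ltW->] := g0 k.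
  - exact: cvg_cst.
  - exact: cvg_harmonic.
exists (fun k => dotp u (hessian f (x + (cd k).1 *: u + (cd k).2 *: v) *m v));
  last by move=> k; have [] := cdP k.
apply: cvg_dotp; first exact: cvg_cst.
apply: cvg_mulmx; last exact: cvg_cst.
have [_ _ Hc] := f2.
apply: (continuous_cvg _ (Hc x)).
have : (fun k => x + (cd k).1 *: u + (cd k).2 *: v) @ \oo -->
    x + 0 *: u + 0 *: v.
  by apply: cvgD; [apply: cvgD; first exact: cvg_cst|]; apply: cvgZr_tmp;
    apply: to0 => k; have [] := cdP k.
by rewrite !scale0r !addr0.
Qed.

(** Symmetry of second derivatives: the second difference is invariant under
    the exchange of its two directions. *)
Lemma hessian_sym f x u v : twice_continuously_differentiable f ->
  dotp u (hessian f x *m v) = dotp v (hessian f x *m u).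
Proof.
move=> f2.
have [H Hcvg HE] := second_difference_seq x u v f2.
have [K Kcvg KE] := second_difference_seq x v u f2.
suff HK : H = K by apply: cvg_unique Hcvg _ => //; rewrite HK.
apply/funext => k; have := HE k.
have -> : second_difference f x u v k.+1%:R^-1 =
          second_difference f x v u k.+1%:R^-1.
  by rewrite /second_difference !(addrAC x (_ *: u) (_ *: v)); ring.
rewrite KE => /mulfI ->//.
Qed.

Lemma hessian_tr f x : twice_continuously_differentiable f ->
  (hessian f x)^T = hessian f x.
Proof.
move=> f2; apply/matrixP => i j.
have delta k l : dotp (delta_mx k 0) (hessian f x *m delta_mx l 0) =
                 hessian f x k l.
  rewrite dotpE (bigD1 k)//= big1 ?addr0.
    by rewrite !mxE !eqxx mul1r (bigD1 l)//= big1 ?addr0 => [|o ol];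
       rewrite !mxE ?eqxx ?mulr1// (negbTE ol) mulr0.
  by move=> o ok; rewrite mxE (negbTE ok) mul0r.
by rewrite mxE -!delta hessian_sym.
Qed.

(** Midpoint convexity makes the second difference along [u] and [u]
    nonnegative. *)
Lemma convex_hessian_psd f x : twice_continuously_differentiable f ->
  convex_function [set: convex_lmodType 'cV[R]_n] f -> psd (hessian f x).
Proof.
move=> f2 fconv u.
have [H Hcvg HE] := second_difference_seq x u u f2.
apply: (cvgr_to_ge Hcvg); apply: nearW => k.
have k0 : 0 < (k.+1%:R^-1 : R) by rewrite invr_gt0.
rewrite -(@pmulr_rge0 _ (k.+1%:R^-1 ^+ 2)) ?exprn_gt0// -HE.
set r := k.+1%:R^-1; have h0 : 0 <= 2^-1 :> R by rewrite invr_ge0.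
have h1 : 2^-1 <= 1 :> R by rewrite invf_le1// ler1n.
have := fconv (Itv01 h0 h1) (x + r *: u + r *: u) x (in_setT _) (in_setT _).
rewrite !convRE/=.
have mid : 2^-1 *: (x + r *: u + r *: u) + (1 - 2^-1) *: x = x + r *: u.
  rewrite scalerBl scale1r -[x + _ + _]addrA scalerDr -mulr2n.
  by rewrite -(scaler_nat 2 (r *: u)) scalerA mulVf// scale1r addrC addrA subrK.
have -> : conv (Itv01 h0 h1) (x + r *: u + r *: u : convex_lmodType _) x =
          x + r *: u :> 'cV[R]_n by exact: mid.
by rewrite /second_difference /unstable.onem; lra.
Qed.
End Hessian.

(** * Monotonicity of the matrix square root *)

Section SquareRoot.
Context {R : realType} {n : nat}.
Implicit Types A B C : 'M[R]_n.

Lemma compact_sphere : compact [set w : 'rV[R]_n | dotp w^T w^T = 1].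
Proof.
apply: bounded_closed_compact.
  exists 1; split => // r r1 w /= w1; apply: le_trans (ltW r1).
  have -> : `|w| = mx_norm w by [].
  have [->|/mx_norm_neq0[[i j] /= ->]] := eqVneq (mx_norm w) 0; first exact: ler01.
  rewrite -(@ler_pXn2r _ 2)// ?nnegrE// expr1n real_normK ?num_real//.
  by have := coord_le_dotp w^T j; rewrite w1 mxE (ord1 i).
apply: (@preimage_closed _ _ (fun w : 'rV[R]_n => dotp w^T w^T)
  [set x | x = 1]); last exact: closed_eq.
by move=> w _; apply: (@cvg_dotp _ _ _ _ (nbhs_filter w));
  exact: trmx_continuous.
Qed.

(** Minimizing the quadratic form on the sphere produces an eigenvector: the
    form of [C - mu] is nonnegative and vanishes at the minimizer. *)
Lemma negative_eigenvector C u : C^T = C -> dotp u (C *m u) < 0 ->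
  exists (mu : R) (v : 'cV[R]_n), [/\ mu < 0, v != 0 & C *m v = mu *: v].
Proof.
move=> Csym Cu.
have normalize (w : 'cV[R]_n) : w != 0 ->
    exists2 s : R, 0 < s & s ^+ 2 * dotp w w = 1.
  rewrite -dotp_gt0 => w0; exists (vnorm w)^-1.
    by rewrite invr_gt0 sqrtr_gt0.
  by rewrite exprVn vnorm_sqr mulVf// gt_eqF.
have u0 : u != 0 by apply: contraTneq Cu => ->; rewrite mulmx0 dotp0r ltxx.
have fC : continuous (fun w : 'rV[R]_n => dotp w^T (C *m w^T)).
  move=> w; apply: (@cvg_dotp _ _ _ _ (nbhs_filter w));
    first exact: trmx_continuous.
  apply: (@cvg_mulmx _ _ _ _ _ _ (nbhs_filter w)); first exact: cvg_cst.
  exact: trmx_continuous.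
have sphere0 : [set w : 'rV[R]_n | dotp w^T w^T = 1] !=set0.
  have [s s0 s1] := normalize _ u0; exists (s *: u)^T.
  by rewrite /= trmxK !dotp_linE mulrA -expr2.
have [w1] := compact_EVT_min sphere0 compact_sphere (continuous_subspaceT fC).
rewrite inE/=; set v := w1^T => v1 vmin.
pose mu := dotp v (C *m v).
have Cmu w : mu * dotp w w <= dotp w (C *m w).
  have [->|/normalize[s s0 s1]] := eqVneq w 0; first by rewrite mulmx0 !dotp0r mulr0.
  have := vmin (s *: w)^T; rewrite inE/= trmxK -scalemxAr !dotp_linE !mulrA.
  rewrite -!expr2 => /(_ s1) smin.
  by rewrite -(@ler_pM2l _ (s ^+ 2)) ?exprn_gt0// mulrCA s1 mulr1.
have mu0 : mu < 0.
  by rewrite ltNge; apply/negP => mu0; have := Cmu u; rewrite leNgt => /negP;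
    apply; rewrite (lt_le_trans Cu)// mulr_ge0// dotp_ge0.
exists mu, v; split => //; first by rewrite -dotp_eq0 v1 oner_eq0.
have psdC : psd (C - mu%:M).
  by move=> w; rewrite mulmxBl mul_scalar_mx dotpBr dotpZr subr_ge0.
have symC : (C - mu%:M)^T = C - mu%:M by rewrite linearB/= Csym tr_scalar_mx.
apply/eqP; rewrite -subr_eq0 -mul_scalar_mx -mulmxBl -dotp_eq0 -sqrf_eq0.
rewrite eq_le sqr_ge0 andbT (le_trans (psd_cauchy_schwarz _ v symC psdC))//.
by rewrite [X in _ * X](_ : _ = 0) ?mulr0// mulmxBl mul_scalar_mx dotpBr dotpZr
  v1 mulr1 subrr.
Qed.

(** Loewner-Heinz inequality for the square root.  If [v] is an eigenvector of
    [A - B] for an eigenvalue [mu < 0], then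
    [|A v|^2 - |B v|^2 = mu <v, (A + B) v>].  The left side is nonnegative, so
    that [<v, A v> = <v, B v> = 0], which contradicts [<v, (A - B) v> = mu |v|^2 < 0]. *)
Lemma loewner_heinz A B : A^T = A -> B^T = B -> psd A -> psd B ->
  loewner_ge (A *m A) (B *m B) -> loewner_ge A B.
Proof.
move=> Asym Bsym Apsd Bpsd AB u; rewrite leNgt; apply/negP => u0.
have Csym : (A - B)^T = A - B by rewrite linearB/= Asym Bsym.
have [mu [v [mu0 v0 Cv]]] := negative_eigenvector Csym u0.
have ABv : dotp v ((A *m A - B *m B) *m v) = mu * (dotp v (A *m v) + dotp v (B *m v)).
  rewrite mulmxBl -!mulmxA dotpBr (dotp_sym _ (A *m v) Asym) (dotp_sym _ (B *m v) Bsym).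
  rewrite -dotpDr -dotpZl -Cv mulmxBl !dotp_linE.
  by rewrite (dotpC (B *m v) (A *m v)); ring.
have := AB v; rewrite ABv (nmulr_rge0 _ mu0) => ABv0.
have /eqP := congr1 (dotp v) Cv; rewrite mulmxBl dotpBr dotpZr.
have := Apsd v; have := Bpsd v; rewrite -dotp_gt0 -(nmulr_rlt0 _ mu0) in v0.
by move=> b0 a0 /eqP; lra.
Qed.

End SquareRoot.

(** * Limits and subgradients *)

Section Sequences.
Context {R : realType}.

Lemma lower_semicontinuous_limit (T : topologicalType) (P : T -> \bar R)
    (ys : nat -> T) (c : R^nat) y0 c0 :
  lower_semicontinuous P -> ys @ \oo --> y0 -> c @ \oo --> c0 ->
  (forall k, (P (ys k) <= (c k)%:E)%E) -> (P y0 <= c0%:E)%E.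
Proof.
move=> lscP ysy cc Pc; rewrite leNgt; apply/negP => c0P.
have [a c0a aP] : exists2 a, c0 < a & (a%:E < P y0)%E.
  case: (P y0) c0P => [r| |]//.
    by rewrite lte_fin => c0r; exists ((c0 + r) / 2); rewrite ?lte_fin; lra.
  by move=> _; exists (c0 + 1); [lra|exact: ltry].
have [V yV VP] := lscP _ _ aP.
have yVk : \forall k \near \oo, V (ys k) by exact: ysy yV.
have [k [Vk ck]] := filter_ex (filterI yVk (cvgr_lt c0 cc _ c0a)).
by have := lt_le_trans (VP _ Vk) (Pc k); rewrite lte_fin ltNge (ltW ck).
Qed.

(** The indices need not increase: [k <= ts k] is enough for limits of the full
    sequence to pass to it. *)
Lemma cluster_subsequence (T : pseudoMetricType R) (w : nat -> T) p :
  cluster (w @ \oo) p ->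
  exists2 ts : nat -> nat, (forall k, (k <= ts k)%N) & w \o ts @ \oo --> p.
Proof.
move=> wp.
have /choice[ts tsP] : forall k : nat, exists t, (k <= t)%N /\
    ball p (k.+1%:R^-1) (w t).
  move=> k; have k0 : 0 < (k.+1%:R^-1 : R) by rewrite invr_gt0.
  have wk : (w @ \oo) [set w t | t in [set t | (k <= t)%N]].
    by exists k => // t kt; exists t.
  by have [_ [[t kt <-] pt]] := wp _ _ wk (nbhsx_ballx p _ k0); exists t.
exists ts; first by move=> k; have [] := tsP k.
apply/cvg_ballP => e e0; near=> k.
have [_] := tsP k; apply: le_ball; apply: ltW; near: k.
exact: (near_infty_natSinv_lt (PosNum e0)).
Unshelve. all: by end_near. Qed.

Lemma cvg_subseq (T : topologicalType) (u : nat -> T) (l : T) (ts : nat -> nat) :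
  (forall k, (k <= ts k)%N) -> u @ \oo --> l -> u \o ts @ \oo --> l.
Proof.
move=> tsk ul A /ul[N _ NA]; exists N => // k /= Nk.
by apply: NA => /=; exact: leq_trans (tsk k).
Qed.

(** A quadratic minorant touching [P] at [x] makes its slope a Frechet
    subgradient: the quadratic error is negligible after division by the
    distance. *)
Lemma proximal_frechet_subdiff m (P : 'cV[R]_m -> \bar R) x v (p C : R) :
  P x = p%:E -> 0 <= C ->
  (forall y, ((p + dotp v (y - x) - C * dotp (y - x) (y - x))%:E <= P y)%E) ->
  frechet_subdiff P x v.
Proof.
move=> Px C0 PC; split; first by rewrite Px ltry.
rewrite limf_einfE; apply/lee_addgt0Pr => e e0.
rewrite -leeBlDr// sub0e.
pose d := e / (C + 1).
have d0 : 0 < d by rewrite divr_gt0// ltr_wpDl.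
pose A := [set y | y != x /\ dotp (y - x) (y - x) < d ^+ 2].
have xA : x^' A.
  have near_x : \forall y \near x, dotp (y - x) (y - x) < d ^+ 2.
    have : (fun y => dotp (y - x) (y - x)) @ x --> dotp (x - x) (x - x).
      by apply: (@cvg_dotp _ _ _ _ (nbhs_filter x));
        apply: cvgB; [exact: cvg_id|exact: cvg_cst|exact: cvg_id|exact: cvg_cst].
    rewrite subrr dotp0r => /cvgr_lt; apply; exact: exprn_gt0.
  by apply: filterS near_x => y yd yx; split.
apply: le_trans (ereal_sup_ubound _); last by exists A.
apply: le_ereal_inf_tmp => _ [y [yx yd] <-].
have yx0 : 0 < dotp (y - x) (y - x) by rewrite dotp_gt0 subr_eq0.
have r0 : 0 < vnorm (y - x) by rewrite sqrtr_gt0.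
move: yd (PC y); rewrite Px -vnorm_sqr; set r := vnorm _ in r0 *.
rewrite ltr_pXn2r ?nnegrE ?(ltW r0) ?(ltW d0)// => rd.
case: (P y) => [q| |].
- rewrite lee_fin -!EFinB -EFinM lee_fin => q0; rewrite ler_pdivlMr//.
  have dE : d * (C + 1) = e by rewrite divfK// gt_eqF// ltr_wpDl.
  have Cr : C * r <= e by rewrite -dE mulrDr mulr1 [d * C]mulrC; nra.
  nra.
- by rewrite addye// gt0_mulye ?leey// lte_fin invr_gt0.
- by [].
Qed.

End Sequences.

(** * Optimality and descent in one iteration *)

Section QuadraticForms.
Context {R : realType}.

(** A vector of the kernel makes the quadratic form vanish. *)
Lemma pd_unitmx n (D : 'M[R]_n) : pd D -> D \in unitmx.
Proof.
move=> Dpd; rewrite -unitmx_tr -row_free_unit; apply: inj_row_free => v vD.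
apply: contrapT => /eqP v0.
have vT0 : v^T != 0 by rewrite -trmx0 (inj_eq trmx_inj).
have := Dpd _ vT0; rewrite (_ : D *m v^T = 0) ?dotp0r ?ltxx//.
by apply: trmx_inj; rewrite trmx_mul trmxK vD trmx0.
Qed.

(** Each coordinate of [u] is the [D]-inner product of [u] with a fixed vector,
    so that the Cauchy-Schwarz inequality for [D] bounds it. *)
Lemma pd_coercive n (D : 'M[R]_n) : D^T = D -> pd D ->
  exists C, forall u, dotp u u <= C * dotp u (D *m u).
Proof.
move=> Dsym Dpd.
have Dpsd : psd D.
  by move=> u; have [->|/Dpd/ltW//] := eqVneq u 0; rewrite mulmx0 dotp0r.
pose w (i : 'I_n) := invmx D *m delta_mx i (0 : 'I_1).
exists (\sum_i dotp (w i) (D *m w i)) => u.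
rewrite mulr_suml [leLHS]dotpE; apply: ler_sum => i _.
have <- : dotp u (D *m w i) = u i 0.
  rewrite mulmxA mulmxV ?pd_unitmx// mul1mx dotpE (bigD1 i)//= big1 ?addr0.
    by rewrite mxE !eqxx mulr1.
  by move=> j ji; rewrite mxE (negbTE ji) mulr0.
by rewrite -expr2 mulrC psd_cauchy_schwarz.
Qed.

(** With [A] and [B] the exact squared norms, the difference of the two sides
    is [| (1 - gamma) a + gamma b | ^ 2 / (gamma (1 - gamma))]. *)
Lemma sqnorm_sub_le n (a b : 'cV[R]_n) (gamma A B : R) :
  0 < gamma < 1 -> dotp a a <= A -> dotp b b <= B ->
  dotp (a - b) (a - b) <= gamma^-1 * A + (1 - gamma)^-1 * B.
Proof.
move=> /andP[g0 g1] aA bB.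
have g1' : 0 < 1 - gamma by lra.
have : 0 <= (gamma^-1 * (1 - gamma)^-1) *
    dotp ((1 - gamma) *: a + gamma *: b) ((1 - gamma) *: a + gamma *: b).
  by rewrite mulr_ge0 ?dotp_ge0// mulr_ge0// invr_ge0 ltW.
have -> : (gamma^-1 * (1 - gamma)^-1) *
    dotp ((1 - gamma) *: a + gamma *: b) ((1 - gamma) *: a + gamma *: b) =
    gamma^-1 * dotp a a + (1 - gamma)^-1 * dotp b b - dotp (a - b) (a - b).
  by rewrite !dotp_linE (dotpC b a); field; rewrite !gt_eqF.
have : gamma^-1 * dotp a a <= gamma^-1 * A by rewrite ler_pM2l ?invr_gt0.
have : (1 - gamma)^-1 * dotp b b <= (1 - gamma)^-1 * B.
  by rewrite ler_pM2l ?invr_gt0.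
lra.
Qed.

End QuadraticForms.

Section Step.
Context {R : realType} {n m : nat}.
Variables (M : 'M[R]_(m, n)) (h phi : 'cV[R]_n -> R) (P : 'cV[R]_m -> \bar R).
Variable beta : R.

(** The real number [p] stands for the value of [P] at [y], which is finite at
    every iterate: the smooth part of the argument then stays in [R]. *)
Definition lagrangian (x : 'cV[R]_n) (p : R) (y z : 'cV[R]_m) : R :=
  h x + p - dotp z (M *m x - y) + beta / 2 * dotp (M *m x - y) (M *m x - y).

Lemma aug_lagrangianE x y z p : P y = p%:E ->
  aug_lagrangian M h P beta x y z = (lagrangian x p y z)%:E.
Proof. by move=> Py; rewrite /aug_lagrangian Py vnorm_sqr -!EFinD. Qed.

Lemma y_step_finite x y z : proper_fun P ->
  argmin (fun y' => aug_lagrangian M h P beta x y' z) y ->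
  P y = (fine (P y))%:E.
Proof.
move=> [PNy [y0 Py0]] ymin; rewrite fineK// fin_numE PNy/=.
have := ymin y0; rewrite (@aug_lagrangianE x y0 z (fine (P y0))); last first.
  by rewrite fineK// fin_numE PNy/= lt_eqF.
by rewrite /aug_lagrangian; case: (P y).
Qed.

Lemma y_step_le x y z p y' p' :
  argmin (fun y' => aug_lagrangian M h P beta x y' z) y ->
  P y = p%:E -> P y' = p'%:E -> lagrangian x p y z <= lagrangian x p' y' z.
Proof.
move=> ymin Py Py'; have := ymin y'.
by rewrite (aug_lagrangianE _ _ Py) (aug_lagrangianE _ _ Py').
Qed.

(** Minimality in [y], solved for [P y'], is a quadratic minorant of [P] that
    touches it at [y]. *)
Lemma y_step_subdiff x y z p : proper_fun P -> 0 < beta ->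
  argmin (fun y' => aug_lagrangian M h P beta x y' z) y ->
  P y = p%:E -> frechet_subdiff P y (- z + beta *: (M *m x - y)).
Proof.
move=> [PNy _] beta0 ymin Py.
apply: (@proximal_frechet_subdiff _ _ _ _ _ p (beta / 2)) => //; first by lra.
move=> y'; have [Py'|Py'] := eqVneq (P y') +oo%E; first by rewrite Py' leey.
have Py'E : P y' = (fine (P y'))%:E by rewrite fineK// fin_numE PNy.
rewrite Py'E lee_fin; have := y_step_le ymin Py Py'E; rewrite /lagrangian.
have -> : M *m x - y' = (M *m x - y) - (y' - y) by rewrite opprB addrA subrK.
move: (M *m x - y) (y' - y) => a w.
by rewrite !dotp_linE (dotpC w a); lra.
Qed.

Section XStep.
Hypotheses (h_C2 : twice_continuously_differentiable h)
  (phi_C2 : twice_continuously_differentiable phi).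
Variables (x0 x1 : 'cV[R]_n) (p : R) (y z : 'cV[R]_m).
Hypothesis x1_min : forall x, lagrangian x1 p y z + bregman phi x1 x0 <=
                              lagrangian x p y z + bregman phi x x0.

(** Along each line through [x1] the objective of the step is [h + phi] plus a
    quadratic polynomial, and its derivative vanishes at [x1]. *)
Lemma x_step_optimality :
  M^T *m (z - beta *: (M *m x1 - y)) =
  gradient h x1 + (gradient phi x1 - gradient phi x0).
Proof.
apply: dotp_inj => u; rewrite -dotp_mulmxr.
have [a aE] : exists a, a = M *m x1 - y by exists (M *m x1 - y).
rewrite -aE; pose c1 := - dotp (z - beta *: a) (M *m u) - dotp (gradient phi x0) u.
pose c2 := beta / 2 * dotp (M *m u) (M *m u).
pose g (s : R) := h (x1 + s *: u) + phi (x1 + s *: u) + c1 * s + c2 * (s * s).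
have gd s : is_derive s (1 : R) g (dotp (gradient h (x1 + s *: u)) u +
    dotp (gradient phi (x1 + s *: u)) u + c1 + 2 * c2 * s).
  have hd : is_derive s (1 : R) (fun t => h (x1 + t *: u))
      (dotp (gradient h (x1 + s *: u)) u).
    by apply: is_derive_line; exact: is_derive_gradient.
  have pd : is_derive s (1 : R) (fun t => phi (x1 + t *: u))
      (dotp (gradient phi (x1 + s *: u)) u).
    by apply: is_derive_line; exact: is_derive_gradient.
  have idd : is_derive s (1 : R) (fun t => t : R) 1 by exact: is_derive_id.
  by apply: is_derive_eq; rewrite /GRing.scale/= !mulr1; ring.
have gmin s : g 0 <= g s.
  have := x1_min (x1 + s *: u); rewrite /lagrangian /bregman /g /c1 /c2.
  have -> : M *m (x1 + s *: u) - y = a + s *: (M *m u).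
    by rewrite mulmxDr -scalemxAr aE addrAC.
  have -> : x1 + s *: u - x0 = (x1 - x0) + s *: u by rewrite addrAC.
  rewrite -aE; move: (x1 - x0) => d; rewrite scale0r addr0 !dotp_linE.
  rewrite (dotpC (M *m u) a); lra.
have g0 : is_derive (0 : R) (1 : R) g 0.
  apply: (@derive1_at_min _ g (-1) 1).
  - by lra.
  - by move=> t _; exact: (@ex_derive _ _ _ _ _ _ _ (gd t)).
  - by rewrite in_itv/=; lra.
  - by move=> t _; exact: gmin.
have := @derive_val _ _ _ _ _ _ _ g0; rewrite (@derive_val _ _ _ _ _ _ _ (gd 0)).
rewrite scale0r addr0 /c1 !(dotpDl u) !dotpNl mulr0 addr0 => E.
by apply/eqP; rewrite -subr_eq0 -oppr_eq0 -[X in _ == X]E; apply/eqP; ring.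
Qed.

(** The optimality condition turns the linear part of the decrease into
    [<grad phi x1 - grad phi x0, d>], which is at least [<d, T2 d>].  This is
    the double of the share of [T2] that the curvature bound on
    [Q2 + beta M^T M + T2] borrows, so that half of [T2] remains as a gain. *)
Lemma x_step_descent (Q2 T2 : 'M[R]_n) (delta : R) (d := x1 - x0) :
  (forall x, loewner_ge (hessian h x) Q2) ->
  (forall x, loewner_ge (hessian phi x) T2) ->
  loewner_ge (Q2 + beta *: (M^T *m M) + T2) delta%:M ->
  lagrangian x1 p y z + 2^-1 * dotp d ((delta%:M + T2) *m d) <=
  lagrangian x0 p y z.
Proof.
move=> hQ2 pT2 QM.
have x1d : x1 - d = x0 by rewrite /d opprB addrC subrK.
have x0d : x0 + d = x1 by rewrite /d addrC subrK.
clearbody d.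
have [a aE] : exists a, a = M *m x1 - y by exists (M *m x1 - y).
have [gp gpE] : exists gp, gp = gradient phi x1 - gradient phi x0.
  by exists (gradient phi x1 - gradient phi x0).
have := congr1 (dotp d) x_step_optimality.
rewrite -aE -gpE dotp_mulmxr trmxK dotpDr => opt.
have taylor : dotp (gradient h x1) (- d) + dotp d (Q2 *m d) / 2 <= h x0 - h x1.
  rewrite -x1d; apply: taylor_lower_bound => // w.
  rewrite mulmxN dotpNr dotpNl opprK.
  by have /loewner_geP := hQ2 w; apply.
have gpT : dotp d (T2 *m d) <= dotp d gp.
  have [c _] := mean_value_dotp x0 d d
    (fun y v => is_derive_hessian y v phi_C2) ltr01.
  rewrite scale1r mul1r x0d -dotpBr -gpE => ->.
  by have /loewner_geP := pT2 (x0 + c *: d); apply.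
have /loewner_geP/(_ d) := QM.
rewrite mul_scalar_mx !mulmxDl mul_scalar_mx -scalemxAl -mulmxA !dotp_linE.
rewrite (dotp_mulmxr M^T) trmxK.
have x0a : M *m x0 - y = a - M *m d by rewrite -x1d mulmxBr aE addrAC.
move: opt taylor; rewrite /lagrangian x0a -aE !dotp_linE (dotpC (M *m d) z).
rewrite (dotpC (M *m d) a) (dotpC (gradient h x1) d); lra.
Qed.

End XStep.
End Step.

(** * The potential and the cluster points *)

Section Descent.
Context {R : realType} {n m : nat}.
Variables (M : 'M[R]_(m, n)) (h phi : 'cV[R]_n -> R) (P : 'cV[R]_m -> \bar R).
Variables (beta sigma delta gamma : R) (Q2 Q3 T1 T2 : 'M[R]_n).
Hypotheses (h_C2 : twice_continuously_differentiable h)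
  (phi_C2 : twice_continuously_differentiable phi)
  (phi_convex : convex_function [set: convex_lmodType 'cV[R]_n] phi)
  (beta_gt0 : 0 < beta) (sigma_gt0 : 0 < sigma) (gamma01 : 0 < gamma < 1)
  (MM_ge : loewner_ge (M *m M^T) sigma%:M)
  (h_ge : forall x, loewner_ge (hessian h x) Q2)
  (T1_sym : T1^T = T1) (T2_sym : T2^T = T2) (T2_psd : loewner_ge T2 0)
  (phi_le : forall x,
     loewner_ge (T1 *m T1) (hessian phi x *m hessian phi x))
  (phi_ge : forall x,
     loewner_ge (hessian phi x *m hessian phi x) (T2 *m T2))
  (QM_ge : loewner_ge (Q2 + beta *: (M^T *m M) + T2) delta%:M)
  (Q3_sym : Q3^T = Q3)
  (Q3_ge : forall x, loewner_ge Q3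
     ((hessian h x + hessian phi x) *m (hessian h x + hessian phi x))).

(* The weight of the previous primal increment in the dual estimate, after
   division by [sigma * beta]. *)
Let kappa := (sigma * beta * (1 - gamma))^-1.

(** The matrix [delta I + T2 - 2 / (sigma beta) H_gamma], which the choice of
    [beta] and [phi] makes positive definite. *)
Definition decrease_form : 'M[R]_n :=
  delta%:M + T2 - (2 / (sigma * beta)) *:
    (gamma^-1 *: Q3 + (1 - gamma)^-1 *: (T1 *m T1)).

Let quad (T : 'M[R]_n) d := dotp d (T *m d).

Lemma quad_sq_le (T S : 'M[R]_n) d : S^T = S ->
  loewner_ge T (S *m S) -> dotp (S *m d) (S *m d) <= quad T d.
Proof.
by move=> Ssym /loewner_geP/(_ d); rewrite -mulmxA (dotp_sym _ _ Ssym).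
Qed.

Lemma gradient_phi_increment x d :
  dotp (gradient phi (x + d) - gradient phi x)
       (gradient phi (x + d) - gradient phi x) <= quad (T1 *m T1) d.
Proof.
apply: (increment_sqnorm (A := hessian phi)).
  by move=> y u; exact: is_derive_hessian.
by move=> y; apply: quad_sq_le; [exact: hessian_tr|exact: phi_le].
Qed.

Lemma gradient_sum_increment x d (g := fun x => gradient h x + gradient phi x) :
  dotp (g (x + d) - g x) (g (x + d) - g x) <= quad Q3 d.
Proof.
apply: (@increment_sqnorm _ _ g (fun y => hessian h y + hessian phi y)).
  by move=> y u; rewrite mulmxDl; apply: is_deriveD; exact: is_derive_hessian.
move=> y; apply: quad_sq_le; last exact: Q3_ge.
by rewrite raddfD; congr (_ + _); exact: hessian_tr.
Qed.

Lemma T1_form_ge0 d : 0 <= quad (T1 *m T1) d.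
Proof. by rewrite /quad -mulmxA (dotp_sym _ _ T1_sym) dotp_ge0. Qed.

Lemma decrease_formE d : quad decrease_form d = quad (delta%:M + T2) d -
  2 / (sigma * beta) *
    (gamma^-1 * quad Q3 d + (1 - gamma)^-1 * quad (T1 *m T1) d).
Proof.
rewrite /decrease_form; move: (delta%:M + T2) (T1 *m T1) => A C.
by rewrite /quad mulmxBl -[_ *: _ *m d]scalemxAl mulmxDl -!scalemxAl !dotp_linE.
Qed.

(** One iteration from [(x0, z0)].  The vector [b] is the increment of
    [grad phi] during the previous iteration; it is [0] for an initial point
    with [M^T z0 = grad h x0]. *)
Section OneStep.
Variables (x0 x1 b : 'cV[R]_n) (p : R) (y z0 z1 : 'cV[R]_m) (B : R).
Hypotheses (x1_min : forall x, lagrangian M h beta x1 p y z0 + bregman phi x1 x0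
                         <= lagrangian M h beta x p y z0 + bregman phi x x0)
  (z1E : z1 = z0 - beta *: (M *m x1 - y))
  (bE : M^T *m z0 = gradient h x0 + b) (bB : dotp b b <= B).

Lemma dual_optimality :
  M^T *m z1 = gradient h x1 + (gradient phi x1 - gradient phi x0).
Proof. by rewrite z1E; exact: x_step_optimality x1_min. Qed.

(** By the optimality conditions, [M^T (z1 - z0)] is the increment of
    [grad h + grad phi] minus [b], and surjectivity of [M] lets [M^T] bound
    [z1 - z0]. *)
Lemma dual_increment_le : sigma * dotp (z1 - z0) (z1 - z0) <=
  gamma^-1 * quad Q3 (x1 - x0) + (1 - gamma)^-1 * B.
Proof.
have /loewner_geP/(_ (z1 - z0)) := MM_ge.
rewrite mul_scalar_mx dotpZr -mulmxA dotp_mulmxr => /le_trans; apply.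
rewrite mulmxBr dual_optimality bE.
have := gradient_sum_increment x0 (x1 - x0); rewrite addrC subrK /= => aQ.
have -> : gradient h x1 + (gradient phi x1 - gradient phi x0) -
    (gradient h x0 + b) = gradient h x1 + gradient phi x1 -
    (gradient h x0 + gradient phi x0) - b.
  by apply/colP => i; rewrite !mxE; ring.
exact: sqnorm_sub_le.
Qed.

(** The update of [z] raises the Lagrangian by [|z1 - z0| ^ 2 / beta]; the
    descent of the [x]-step absorbs the part of it that comes from the current
    increment, and the part that comes from [b] is charged to the previous
    one. *)
Lemma potential_decrease :
  lagrangian M h beta x1 p y z1 + kappa * quad (T1 *m T1) (x1 - x0) +
    2^-1 * quad decrease_form (x1 - x0) <=
  lagrangian M h beta x0 p y z0 + kappa * B.
Proof.
have phiT2 x : loewner_ge (hessian phi x) T2.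
  apply: loewner_heinz => //; first exact: hessian_tr.
  - exact: convex_hessian_psd.
  - by move=> u; have := T2_psd u; rewrite subr0.
have := x_step_descent h_C2 phi_C2 x1_min h_ge phiT2 QM_ge.
have zE : lagrangian M h beta x1 p y z1 =
    lagrangian M h beta x1 p y z0 + beta^-1 * dotp (z1 - z0) (z1 - z0).
  rewrite /lagrangian z1E; move: (M *m x1 - y) => a.
  rewrite [z0 - _ - z0]addrAC subrr add0r !dotp_linE.
  by field; rewrite gt_eqF.
have := dual_increment_le; rewrite zE.
move: (dotp (z1 - z0) (z1 - z0)) => w wle.
move: (lagrangian _ _ _ x1 _ _ _) (lagrangian _ _ _ x0 _ _ _) => L1 L0.
rewrite decrease_formE -/(quad _ (x1 - x0)) /kappa; move: wle.
move: (quad Q3 _) (quad (T1 *m T1) _) (quad (_ + _) _) => q3 q1 q2 wle.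
have : beta^-1 * w <= (sigma * beta)^-1 * (gamma^-1 * q3 + (1 - gamma)^-1 * B).
  have -> : beta^-1 * w = (sigma * beta)^-1 * (sigma * w).
    by field; rewrite !gt_eqF.
  by rewrite ler_pM2l ?invr_gt0// mulr_gt0.
rewrite [(_ * (1 - _))^-1]invfM; move: ((sigma * beta)^-1) (gamma^-1) ((1 - gamma)^-1).
move=> s g g'; lra.
Qed.

End OneStep.

Section Iterates.
Variables (x : nat -> 'cV[R]_n) (y z : nat -> 'cV[R]_m).
Hypotheses (P_proper : proper_fun P) (P_closed : lower_semicontinuous P)
  (D_pd : pd decrease_form)
  (y_min : forall t,
     argmin (fun y' => aug_lagrangian M h P beta (x t) y' (z t)) (y t.+1))
  (x_argmin : forall t,
     argmin (fun x' => (aug_lagrangian M h P beta x' (y t.+1) (z t) +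
                        (bregman phi x' (x t))%:E)%E) (x t.+1))
  (z_update : forall t, z t.+1 = z t - beta *: (M *m x t.+1 - y t.+1)).

Let p t := fine (P (y t.+1)).
Let lag := lagrangian M h beta.
Let dx t := x t.+1 - x t.

Lemma P_iterate t : P (y t.+1) = (p t)%:E.
Proof. exact: y_step_finite (y_min t). Qed.

Lemma x_min t x' : lag (x t.+1) (p t) (y t.+1) (z t) + bregman phi (x t.+1) (x t)
  <= lag x' (p t) (y t.+1) (z t) + bregman phi x' (x t).
Proof.
have := x_argmin t x'.
by rewrite !(aug_lagrangianE _ _ _ _ _ (P_iterate t)) -!EFinD lee_fin.
Qed.

(** The Lagrangian alone need not decrease: its rise in the [z]-update depends
    on the previous primal increment, hence the second term. *)
Definition potential t :=
  lag (x t.+1) (p t) (y t.+1) (z t.+1) + kappa * quad (T1 *m T1) (dx t).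

Lemma dual_iterate t : M^T *m z t.+1 =
  gradient h (x t.+1) + (gradient phi (x t.+1) - gradient phi (x t)).
Proof. by apply: (dual_optimality (@x_min t)); exact: z_update. Qed.

Lemma gradient_phi_dx t :
  dotp (gradient phi (x t.+1) - gradient phi (x t))
       (gradient phi (x t.+1) - gradient phi (x t)) <= quad (T1 *m T1) (dx t).
Proof.
have <- : x t + dx t = x t.+1 by rewrite addrC subrK.
exact: gradient_phi_increment.
Qed.

Lemma potential_step t :
  potential t.+1 + 2^-1 * quad decrease_form (dx t.+1) <= potential t.
Proof.
have := potential_decrease (@x_min t.+1) (z_update t.+1) (dual_iterate t)
  (gradient_phi_dx t).
have := y_step_le (y_min t.+1) (P_iterate t.+1) (P_iterate t).
rewrite -/lag /potential /dx; lra.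
Qed.

Lemma decrease_form_ge0 d : 0 <= quad decrease_form d.
Proof.
by have [->|/D_pd/ltW//] := eqVneq d 0; rewrite /quad mulmx0 dotp0r.
Qed.

Lemma potential_nonincreasing : nonincreasing_seq potential.
Proof.
apply/nonincreasing_seqP => t; apply: le_trans (potential_step t).
by rewrite lerDl mulr_ge0// decrease_form_ge0.
Qed.

Lemma dz_le t : sigma * dotp (z t.+2 - z t.+1) (z t.+2 - z t.+1) <=
  gamma^-1 * quad Q3 (dx t.+1) + (1 - gamma)^-1 * quad (T1 *m T1) (dx t).
Proof.
exact: (dual_increment_le (@x_min t.+1) (z_update t.+1) (dual_iterate t)
  (gradient_phi_dx t)).
Qed.

Lemma residualE t : M *m x t.+1 - y t.+1 = beta^-1 *: (z t - z t.+1).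
Proof.
by rewrite z_update opprB addrCA subrr addr0 scalerA mulVf ?gt_eqF// scale1r.
Qed.

Lemma y_iterateE t : y t.+1 = M *m x t.+1 - beta^-1 *: (z t - z t.+1).
Proof. by rewrite -residualE opprB addrC subrK. Qed.

Lemma lagrangian_split x' p' y' z' : lag x' p' y' z' = p' + lag x' 0 y' z'.
Proof. by rewrite /lag /lagrangian; lra. Qed.

Lemma cvg_lagrangian (T : Type) (F : set_system T) {FF : Filter F}
    (xk : T -> 'cV[R]_n) (yk zk : T -> 'cV[R]_m) p' x' y' z' :
  xk @ F --> x' -> yk @ F --> y' -> zk @ F --> z' ->
  (fun k => lag (xk k) p' (yk k) (zk k)) @ F --> lag x' p' y' z'.
Proof.
move=> xx yy zz; rewrite /lag /lagrangian.
have r : (fun k => M *m xk k - yk k) @ F --> M *m x' - y'.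
  by apply: cvgB => //; apply: cvg_mulmx => //; exact: cvg_cst.
apply: cvgD; last by apply: cvgM; [exact: cvg_cst|exact: cvg_dotp].
apply: cvgB; last exact: cvg_dotp.
apply: cvgD; last exact: cvg_cst.
apply: continuous_cvg xx; have [hd _ _] := h_C2.
exact: differentiable_continuous.
Qed.

Section ClusterPoint.
Variables (xs : 'cV[R]_n) (ys zs : 'cV[R]_m) (ts : nat -> nat).
Hypotheses (ts_ge : forall k, (k <= ts k)%N)
  (x_cvg : (fun k => x (ts k).+1) @ \oo --> xs)
  (y_cvg : (fun k => y (ts k).+1) @ \oo --> ys)
  (z_cvg : (fun k => z (ts k).+1) @ \oo --> zs).

(** At all large indices of the subsequence, [P] is at most [potential t] minus
    the finite part of the Lagrangian, and lower semicontinuity passes this to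
    the limit.  It yields both the finiteness of [P ys] and the lower bound
    that makes the potential converge. *)
Lemma P_cluster_le t : (P ys <= (potential t - lag xs 0 ys zs)%:E)%E.
Proof.
pose tk k := ts (k + t)%N.
have sub (T : topologicalType) (u : nat -> T) (l : T) :
    (fun k => u (ts k).+1) @ \oo --> l -> (fun k => u (tk k).+1) @ \oo --> l.
  move=> ul; apply: (cvg_subseq (u := fun k => u (ts k).+1)
    (ts := fun k => (k + t)%N)) => // k; exact: leq_addr.
apply: (lower_semicontinuous_limit P_closed (sub _ _ _ y_cvg)
  (c := fun k => potential t - lag (x (tk k).+1) 0 (y (tk k).+1) (z (tk k).+1))).
  by apply: cvgB; [exact: cvg_cst|apply: cvg_lagrangian; exact: sub].
move=> k; rewrite P_iterate lee_fin lerBrDr -lagrangian_split.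
apply: le_trans (_ : potential (tk k) <= _).
  rewrite lerDl mulr_ge0 ?T1_form_ge0// invr_ge0 !mulr_ge0 ?(ltW sigma_gt0)//.
    exact: ltW.
  by have /andP[_ /ltW] := gamma01; rewrite subr_ge0.
by apply: potential_nonincreasing; exact: leq_trans (leq_addl _ _) (ts_ge _).
Qed.

Lemma P_clusterE : P ys = (fine (P ys))%:E.
Proof.
have [PNy _] := P_proper; rewrite fineK// fin_numE PNy/= -ltey.
exact: le_lt_trans (P_cluster_le 0) (ltry _).
Qed.

Lemma potential_ge t : lag xs (fine (P ys)) ys zs <= potential t.
Proof.
have := P_cluster_le t; rewrite P_clusterE lee_fin lerBrDr.
by rewrite -lagrangian_split.
Qed.

(** The potential decreases and is bounded below, so its successive differences
    tend to [0]; they dominate the squared primal increments. *)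
Lemma dx_cvg : dx @ \oo --> (0 : 'cV[R]_n).
Proof.
have D_sym : decrease_form^T = decrease_form.
  rewrite /decrease_form raddfB raddfD/= tr_scalar_mx T2_sym.
  congr (_ - _); rewrite linearZ/= raddfD/=; congr (_ *: (_ + _));
    by rewrite linearZ/= ?Q3_sym// trmx_mul T1_sym.
have [C CD] := pd_coercive D_sym D_pd.
have pot_cvg : cvgn potential.
  apply: nonincreasing_is_cvgn; first exact: potential_nonincreasing.
  by exists (lag xs (fine (P ys)) ys zs) => _ [t _ <-]; exact: potential_ge.
have pot_diff : (fun t => potential t - potential t.+1) @ \oo --> (0 : R).
  rewrite -(subrr (lim (potential @ \oo))); apply: cvgB => //.
  exact: (cvg_subseq (u := potential) (ts := S)).
rewrite -cvg_shiftS; apply: cvg0_dotp.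
apply: (@squeeze_cvgr _ _ _ _ (cst 0)
  (fun t => `|C| * (2 * (potential t - potential t.+1)))).
- apply: nearW => t; rewrite dotp_ge0/= (le_trans (CD _))//.
  apply: (@le_trans _ _ (`|C| * quad decrease_form (dx t.+1))).
    by rewrite ler_wpM2r ?decrease_form_ge0// ler_norm.
  by rewrite ler_wpM2l//; have := potential_step t; lra.
- exact: cvg_cst.
- rewrite -[X in _ --> X](mulr0 `|C|); apply: cvgM; first exact: cvg_cst.
  rewrite -[X in _ --> X](mulr0 2); apply: cvgM => //; exact: cvg_cst.
Qed.

Lemma cvg_quad0 (T : 'M[R]_n) (f : nat -> 'cV[R]_n) :
  f @ \oo --> (0 : 'cV[R]_n) -> (fun t => quad T (f t)) @ \oo --> (0 : R).
Proof.
move=> f0; rewrite -(dotp0r (0 : 'cV[R]_n)) -{2}(mulmx0 _ T).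
by apply: cvg_dotp => //; apply: cvg_mulmx => //; exact: cvg_cst.
Qed.

Lemma dz_cvg : (fun t => z t.+1 - z t) @ \oo --> (0 : 'cV[R]_m).
Proof.
rewrite -cvg_shiftS; apply: cvg0_dotp.
apply: (@squeeze_cvgr _ _ _ _ (cst 0) (fun t => sigma^-1 *
  (gamma^-1 * quad Q3 (dx t.+1) + (1 - gamma)^-1 * quad (T1 *m T1) (dx t)))).
- apply: nearW => t; rewrite dotp_ge0/= -(@ler_pM2l _ sigma)// mulrA.
  by rewrite divff ?gt_eqF// mul1r dz_le.
- exact: cvg_cst.
- rewrite -[X in _ --> X](mulr0 sigma^-1); apply: cvgM; first exact: cvg_cst.
  rewrite -[X in _ --> X](addr0 (0 : R)); apply: cvgD.
    rewrite -[X in _ --> X](mulr0 gamma^-1); apply: cvgM; first exact: cvg_cst.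
    by apply: cvg_quad0; apply: (cvg_subseq (ts := S)) dx_cvg.
  rewrite -[X in _ --> X](mulr0 (1 - gamma)^-1); apply: cvgM; first exact: cvg_cst.
  exact: cvg_quad0 dx_cvg.
Qed.

Lemma residual_cvg : (fun t => M *m x t.+1 - y t.+1) @ \oo --> (0 : 'cV[R]_m).
Proof.
under eq_fun do rewrite residualE -opprB scalerN -scaleNr.
rewrite -(scaler0 _ (- beta^-1)); apply: cvgZl_tmp; exact: dz_cvg.
Qed.

Lemma dy_cvg : (fun t => y t.+1 - y t) @ \oo --> (0 : 'cV[R]_m).
Proof.
rewrite -cvg_shiftS.
pose r t := M *m x t.+1 - y t.+1.
have -> : [sequence y t.+2 - y t.+1]_t =
    (fun t => M *m dx t.+1 - (r t.+1 - r t)) :> (nat -> 'cV[R]_m).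
  by apply/funext => t /=; rewrite /r /dx mulmxBr; apply/colP => i; rewrite !mxE; ring.
have -> : (0 : 'cV[R]_m) = M *m 0 - (0 - 0) by rewrite mulmx0 !subr0.
apply: cvgB; first apply: cvg_mulmx; first exact: cvg_cst.
  exact: (cvg_subseq (ts := S)) dx_cvg.
by apply: cvgB; [apply: (cvg_subseq (ts := S)) residual_cvg|exact: residual_cvg].
Qed.

Lemma increments_cvg :
  (fun t => vnorm (y t.+1 - y t) ^+ 2 + vnorm (x t.+1 - x t) ^+ 2
            + vnorm (z t.+1 - z t) ^+ 2) @ \oo --> (0 : R).
Proof.
under eq_fun do rewrite !vnorm_sqr.
rewrite -(addr0 (0 : R)) -{1}(addr0 (0 : R)).
rewrite -{1}(dotp0r (0 : 'cV[R]_m)) -{1}(dotp0r (0 : 'cV[R]_n)).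
rewrite -(dotp0r (0 : 'cV[R]_m)).
by apply: cvgD; [apply: cvgD|]; apply: cvg_dotp;
  [exact: dy_cvg|exact: dy_cvg|exact: dx_cvg|exact: dx_cvg
  |exact: dz_cvg|exact: dz_cvg].
Qed.

Lemma cluster_feasible : ys = M *m xs.
Proof.
have r0 := cvg_subseq ts_ge residual_cvg.
have r1 : (fun k => M *m x (ts k).+1 - y (ts k).+1) @ \oo --> M *m xs - ys.
  by apply: cvgB => //; apply: cvg_mulmx => //; exact: cvg_cst.
apply/esym/eqP; rewrite -subr_eq0; apply/eqP.
exact: (cvg_unique _ r1 r0).
Qed.

Lemma cluster_gradient : gradient h xs = M^T *m zs.
Proof.
have Mz : (fun k => M^T *m z (ts k).+1) @ \oo --> M^T *m zs.
  by apply: cvg_mulmx => //; exact: cvg_cst.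
have dphi : (fun t => gradient phi (x t.+1) - gradient phi (x t)) @ \oo -->
    (0 : 'cV[R]_n).
  apply: cvg0_dotp; apply: (@squeeze_cvgr _ _ _ _ (cst 0)
    (fun t => quad (T1 *m T1) (dx t))).
  - by apply: nearW => t; rewrite dotp_ge0 gradient_phi_dx.
  - exact: cvg_cst.
  - exact: cvg_quad0 dx_cvg.
have gh : (fun k => gradient h (x (ts k).+1) +
    (gradient phi (x (ts k).+1) - gradient phi (x (ts k)))) @ \oo -->
    gradient h xs + 0.
  apply: cvgD; last exact: cvg_subseq ts_ge dphi.
  by apply: continuous_cvg x_cvg; exact: continuous_gradient.
rewrite addr0 in gh; apply: cvg_unique gh _ => //.
rewrite (_ : (fun k => _) = (fun k => M^T *m z (ts k).+1))//.
by apply/funext => k; rewrite -dual_iterate.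
Qed.

(** The [y]-steps produce Frechet subgradients at [y (ts k).+1] that tend to
    [- zs].  The values of [P] converge as well: comparing [y (ts k).+1] with
    [ys] in the [y]-step bounds them from above, and lower semicontinuity
    bounds them from below. *)
Lemma cluster_subdiff : limiting_subdiff P ys (- zs).
Proof.
have shift q (u : nat -> 'cV[R]_q) (l : 'cV[R]_q) :
    (fun t => u t.+1 - u t) @ \oo --> (0 : 'cV[R]_q) ->
    (fun k => u (ts k).+1) @ \oo --> l -> (fun k => u (ts k)) @ \oo --> l.
  move=> du ul; rewrite -(subr0 l).
  have -> : (fun k => u (ts k)) =
      (fun k => u (ts k).+1 - (u (ts k).+1 - u (ts k))).
    by apply/funext => k; rewrite opprB addrC subrK.
  by apply: cvgB => //; exact: cvg_subseq ts_ge du.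
(* The [y]-step that produces [y (ts k).+1] uses [x] and [z] at [ts k]. *)
have x0_cvg := shift _ _ _ dx_cvg x_cvg.
have z0_cvg := shift _ _ _ dz_cvg z_cvg.
split; first by rewrite P_clusterE ltry.
exists (fun k => y (ts k).+1),
  (fun k => - z (ts k) + beta *: (M *m x (ts k) - y (ts k).+1)).
split.
- exact: y_cvg.
- pose ps := fine (P ys).
  have upper k : p (ts k) <= ps + lag (x (ts k)) 0 ys (z (ts k)) -
      lag (x (ts k)) 0 (y (ts k).+1) (z (ts k)).
    have := y_step_le (y_min (ts k)) (P_iterate (ts k)) P_clusterE.
    by rewrite -/lag lagrangian_split [in X in _ <= X]lagrangian_split lerBrDr.
  have upper_cvg : (fun k => ps + lag (x (ts k)) 0 ys (z (ts k)) -
      lag (x (ts k)) 0 (y (ts k).+1) (z (ts k))) @ \oo --> ps.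
    rewrite -[X in _ --> X](addrK (lag xs 0 ys zs)).
    apply: cvgB; last exact: cvg_lagrangian.
    by apply: cvgD; [exact: cvg_cst|apply: cvg_lagrangian => //; exact: cvg_cst].
  rewrite P_clusterE.
  have -> : P \o (fun k => y (ts k).+1) = EFin \o (fun k => p (ts k)).
    by apply/funext => k /=; rewrite P_iterate.
  apply: cvg_EFin; first exact: nearW.
  apply/cvgrPdist_lt => e e0.
  have [V yV VP] : exists2 V, nbhs ys V & forall y', V y' -> ((ps - e)%:E < P y')%E.
    by apply: P_closed; rewrite P_clusterE lte_fin ltrBlDr ltrDl.
  have lower : \forall k \near \oo, ps - e < p (ts k).
    have Vy : \forall k \near \oo, V (y (ts k).+1) by exact: y_cvg yV.
    by apply: filterS Vy => k /VP; rewrite P_iterate lte_fin.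
  have ps_lt : ps < ps + e by rewrite ltrDl.
  apply: filterS2 lower (cvgr_lt ps upper_cvg _ ps_lt) => k lk uk.
  rewrite /= ltr_distlC lk/=; exact: le_lt_trans (upper k) uk.
- rewrite -(addr0 (- zs)); apply: cvgD; first exact: cvgN.
  rewrite -(scaler0 _ beta) -(subrr ys) {1}cluster_feasible.
  apply: cvgZl_tmp; apply: cvgB => //.
  by apply: cvg_mulmx => //; exact: cvg_cst.
- by move=> k; exact: y_step_subdiff (P_iterate (ts k)).
Qed.

Lemma cluster_stationary : stationary M h P xs.
Proof.
exists (- zs); first by rewrite -cluster_feasible; exact: cluster_subdiff.
by rewrite mulmxN cluster_gradient subrr.
Qed.

Lemma cluster_optimality :
  (fun t => vnorm (y t.+1 - y t) ^+ 2 + vnorm (x t.+1 - x t) ^+ 2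
            + vnorm (z t.+1 - z t) ^+ 2) @ \oo --> (0 : R)
  /\ stationary M h P xs
  /\ [/\ gradient h xs = M^T *m zs, limiting_subdiff P ys (- zs)
       & ys = M *m xs].
Proof.
split; first exact: increments_cvg.
split; first exact: cluster_stationary.
split; [exact: cluster_gradient|exact: cluster_subdiff|exact: cluster_feasible].
Qed.

(** At a feasible point the Lagrangian is the objective. *)
Lemma cluster_objective_le t : (objective M h P xs <= (potential t)%:E)%E.
Proof.
have := potential_ge t; rewrite /lag /lagrangian /objective -cluster_feasible.
by rewrite P_clusterE subrr !dotp0r mulr0 addr0 subr0 -EFinD lee_fin.
Qed.

(** If the first step leaves [x 0] unchanged, it also leaves [z 0] unchanged,
    and the optimality conditions of the first step are the stationarity of
    [x 0]; otherwise the potential decreases strictly. *)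
Lemma cluster_objective_lt :
  ~ stationary M h P (x 0) -> (objective M h P (x 0) < +oo)%E ->
  M^T *m z 0 = gradient h (x 0) ->
  (objective M h P xs < objective M h P (x 0))%E.
Proof.
move=> nonstat fin_x0 z0E.
have [PNy _] := P_proper.
have Px0 : P (M *m x 0) = (fine (P (M *m x 0)))%:E.
  rewrite fineK// fin_numE PNy/=; apply/negP => /eqP Px0.
  by move: fin_x0; rewrite /objective Px0 addey.
have z0E0 : M^T *m z 0 = gradient h (x 0) + 0 by rewrite addr0.
have b0 : dotp (0 : 'cV[R]_n) 0 <= 0 by rewrite dotp0r.
have obj0 : objective M h P (x 0) =
    (lag (x 0) (fine (P (M *m x 0))) (M *m x 0) (z 0))%:E.
  rewrite /objective /lag /lagrangian Px0.
  by rewrite subrr !dotp0r mulr0 addr0 subr0 -EFinD.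
apply: le_lt_trans (cluster_objective_le 0) _; rewrite obj0 lte_fin.
have := potential_decrease (@x_min 0) (z_update 0) z0E0 b0.
have := y_step_le (y_min 0) (P_iterate 0) Px0.
rewrite -/lag mulr0 addr0 -/(dx 0) -/(potential 0) => y_le pot_le.
have : dx 0 != 0.
  apply/eqP => dx0; apply: nonstat.
  have z10 : z 1 - z 0 = 0.
    apply/eqP; rewrite -dotp_eq0 eq_le dotp_ge0 andbT -(@ler_pM2l _ sigma)//.
    rewrite mulr0; have := dual_increment_le (@x_min 0) (z_update 0) z0E0 b0.
    by rewrite -/(dx 0) dx0 /quad mulmx0 dotp0r !mulr0 addr0.
  have y1 : y 1 = M *m x 0.
    rewrite y_iterateE -(opprB (z 1)) z10 oppr0 scaler0 subr0.
    by congr (_ *m _); apply/eqP; rewrite -subr_eq0; apply/eqP.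
  have sub0 : frechet_subdiff P (M *m x 0) (- z 0).
    have := y_step_subdiff P_proper beta_gt0 (y_min 0) (P_iterate 0).
    by rewrite y1 subrr scaler0 addr0.
  exists (- z 0); last by rewrite mulmxN z0E subrr.
  split; first by rewrite Px0 ltry.
  exists (cst (M *m x 0)), (cst (- z 0)).
  split=> //; [exact: cvg_cst|exact: (cvg_cst (P (M *m x 0)))|exact: cvg_cst].
by move=> /D_pd; rewrite -/(quad _ _); lra.
Qed.

End ClusterPoint.
End Iterates.
End Descent.

Unset Implicit Arguments.
Set Strict Implicit.
Set Printing Implicit Defensive.

Theorem theorem1 (R : realType) (n m : nat) (M : 'M[R]_(m, n))
    (h : 'cV[R]_n -> R) (P : 'cV[R]_m -> \bar R)
    (beta : R) (phi : 'cV[R]_n -> R) (x0 : 'cV[R]_n) (z0 : 'cV[R]_m)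
    (x : nat -> 'cV[R]_n) (y z : nat -> 'cV[R]_m)
    (h_C2 : twice_continuously_differentiable h)
    (h_bounded_hessian : [bounded hessian h u | u in [set: 'cV[R]_n]])
    (P_proper : proper_fun P)
    (P_closed : lower_semicontinuous P)
    (P_prox : prox_nonempty P)
    (beta_gt0 : 0 < beta)
    (phi_C2 : twice_continuously_differentiable phi)
    (phi_convex : convex_function [set: convex_lmodType 'cV[R]_n] phi)
    (HA : assumptionA M h beta phi)
    (Hadmm : proximal_admm M h P beta phi x0 z0 x y z) :
  (forall (xs : 'cV[R]_n) (ys zs : 'cV[R]_m),
     cluster ((fun t => (x t, y t, z t)) @ \oo) (xs, ys, zs) ->
     ((fun t => vnorm (y t.+1 - y t) ^+ 2 + vnorm (x t.+1 - x t) ^+ 2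
                + vnorm (z t.+1 - z t) ^+ 2) @ \oo --> (0 : R))
     /\ stationary M h P xs
     /\ [/\ gradient h xs = M^T *m zs, limiting_subdiff P ys (- zs)
          & ys = M *m xs])
  /\
  (~ stationary M h P x0 ->
   (objective M h P x0 < +oo)%E ->
   M^T *m z0 = gradient h x0 ->
   forall (xs : 'cV[R]_n) (ys zs : 'cV[R]_m),
     cluster ((fun t => (x t, y t, z t)) @ \oo) (xs, ys, zs) ->
     (objective M h P xs < objective M h P x0)%E).
Proof.
case: HA => sigma [delta [gamma [Q1 [Q2 [Q3 [T1 [T2 HA]]]]]]].
case: HA => -[sigma_gt0 MM_ge] [_ _ h_bounds] [/symmetricmx_tr T1_sym
  /symmetricmx_tr T2_sym _ T2_psd phi_bounds] [_ QM_ge]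
  [/symmetricmx_tr Q3_sym Q3_ge gamma01 D_pd].
case: Hadmm => x00 z00 step.
have h_ge u : loewner_ge (hessian h u) Q2 by have [] := h_bounds u.
have phi_le u := (phi_bounds u).1; have phi_ge u := (phi_bounds u).2.
have y_min t : argmin (fun y' => aug_lagrangian M h P beta (x t) y' (z t)) (y t.+1).
  by have [] := step t.
have x_argmin t : argmin (fun x' => (aug_lagrangian M h P beta x' (y t.+1) (z t) +
    (bregman phi x' (x t))%:E)%E) (x t.+1) by have [] := step t.
have z_update t : z t.+1 = z t - beta *: (M *m x t.+1 - y t.+1).
  by have [] := step t.
(* As [y 0] is arbitrary, the subsequence is kept at successor indices. *)
have subsequence xs ys zs :
    cluster ((fun t => (x t, y t, z t)) @ \oo) (xs, ys, zs) ->
    exists ts : nat -> nat, [/\ forall k, (k <= ts k)%N,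
      (fun k => x (ts k).+1) @ \oo --> xs, (fun k => y (ts k).+1) @ \oo --> ys &
      (fun k => z (ts k).+1) @ \oo --> zs].
  move=> /cluster_subsequence[ts ts_ge w_cvg].
  have ts_gt0 k : (ts k.+1).-1.+1 = ts k.+1.
    by rewrite prednK//; exact: leq_trans (ts_ge k.+1).
  have {}w_cvg := cvg_subseq (ts := S) leqnSn w_cvg.
  exists (fun k => (ts k.+1).-1); split.
  - by move=> k; rewrite -ltnS ts_gt0.
  - under eq_fun do rewrite ts_gt0.
    exact: (cvg_comp _ _ (cvg_comp _ _ w_cvg cvg_fst) cvg_fst).
  - under eq_fun do rewrite ts_gt0.
    exact: (cvg_comp _ _ (cvg_comp _ _ w_cvg cvg_fst) cvg_snd).
  - under eq_fun do rewrite ts_gt0.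
    exact: (cvg_comp _ _ w_cvg cvg_snd).
split=> [xs ys zs /subsequence[ts [ts_ge xc yc zc]]|
  nonstat obj0 z0E xs ys zs /subsequence[ts [ts_ge xc yc zc]]].
  exact: (cluster_optimality h_C2 phi_C2 phi_convex beta_gt0 sigma_gt0 gamma01
    MM_ge h_ge T1_sym T2_sym T2_psd phi_le phi_ge QM_ge Q3_sym Q3_ge P_proper
    P_closed D_pd y_min x_argmin z_update ts_ge xc yc zc).
rewrite -x00 -z00 in nonstat obj0 z0E *.
exact: (cluster_objective_lt h_C2 phi_C2 phi_convex beta_gt0 sigma_gt0 gamma01
  MM_ge h_ge T1_sym T2_sym T2_psd phi_le phi_ge QM_ge Q3_sym Q3_ge P_proper
  P_closed D_pd y_min x_argmin z_update ts_ge xc yc zc).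
Qed.
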